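(* Let $N\in\mathbb{N}$, let $\tilde W=(\tilde w_{i,j})\in(\mathbb{R}_0^+)^{N\times N}$ be a weight matrix with $\tilde w_{i,i}>0$ for all $i$, and let $L_\Phi$ be the Lipschitz constant of $\Phi$ restricted to the interval $(0,2)$. Let $0<v_i^k<1$ for every $1\le i\le N$, and assume that the time step size $\tau$ of the explicit scheme $$v_i^{k+1}=v_i^k+\tau\sum_{\ell\in J_2^i}\tilde w_{i,\ell}\,\Phi(v_\ell^k-v_i^k)-\tau\sum_{\ell=1}^N\tilde w_{i,\ell}\,\Phi(v_\ell^k+v_i^k),\qquad i=1,\ldots,N,$$ satisfies $$0<\tau<\frac{1}{2\,L_\Phi\,\max_{1\le i\le N}\sum_{\ell=1}^N\tilde w_{i,\ell}}.$$ Then $0<v_i^{k+1}<1$ for every $1\le i\le N$.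
   Context: $J_2^i:=\{\ell\in\{1,\ldots,N\}\mid v_\ell^k\neq v_i^k\}$. The upper index $k$ is the time level (time $k\tau$). Penaliser and flux: $\Psi:\mathbb{R}_0^+\to\mathbb{R}$ is such that $s\mapsto\Psi(s^2)$ is continuously differentiable, decreasing and strictly convex on $[0,1]$, with $\Psi(0)=0$ and vanishing left-sided derivative at $s=1$. It is extended to $[-1,1]$ by symmetry (evenness) and to $\mathbb{R}$ by periodicity $\Psi((2+s)^2)=\Psi(s^2)$. The flux is $\Phi(s):=\Psi'(s^2)\,s$, i.e. half the derivative of $s\mapsto\Psi(s^2)$, defined for $s$ not an even integer. Hence $\Phi(-s)=-\Phi(s)$, $\Phi(2+s)=\Phi(s)$, $\Phi$ is continuous and increasing on $(0,2)$, $\Phi(1)=0$, and $\Phi$ has jump discontinuities at the even integers. $\Phi$ is assumed Lipschitz on $(0,2)$. *)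

(* Defs.v *)
From HB Require Import structures.
From mathcomp Require Export all_boot all_order all_algebra.
From mathcomp Require Export all_classical all_reals all_analysis.
Export Order.TTheory GRing.Theory Num.Theory.
Export numFieldNormedType.Exports.

Set Implicit Arguments.
Unset Strict Implicit.
Unset Printing Implicit Defensive.

Local Open Scope classical_set_scope.
Local Open Scope ring_scope.

(* Derivatives are taken relative to [a, b], hence one-sided at a and b. *)
Definition C1_on {R : realType} (a b : R) (f : R -> R) : Prop :=
  exists df : R -> R,
    (forall x, x \in `[a, b] ->
       (f y - f x) / (y - x) @[y --> within `[a, b] x^'] --> df x)
    /\ {within `[a, b], continuous df}.

Definition strictly_convex_on {R : realType} (a b : R) (f : R -> R) : Prop :=
  forall x y t : R, x \in `[a, b] -> y \in `[a, b] -> x != y -> 0 < t < 1 ->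
    f (t * x + (1 - t) * y) < t * f x + (1 - t) * f y.

(* Psi is a function on the nonnegative reals: its values on negative arguments
   are irrelevant, since it is only ever inspected through s |-> Psi (s^2) and
   through its derivative at s^2 > 0.  That s |-> Psi (s^2) is even is
   automatic.  Monotonicity is the non-strict one; strict monotonicity on
   [0, 1] follows from it by strict convexity. *)
Record penaliser {R : realType} (Psi : R -> R) : Prop := Penaliser {
  penaliser_C1 : C1_on 0 1 (fun s => Psi (s ^+ 2));
  penaliser_decreasing :
    {in `[0, 1] &, forall s t : R, s <= t -> Psi (t ^+ 2) <= Psi (s ^+ 2)};
  penaliser_convex : strictly_convex_on 0 1 (fun s => Psi (s ^+ 2));
  penaliser_0 : Psi 0 = 0;
  penaliser_left_deriv1 :
    (Psi (s ^+ 2) - Psi (1 ^+ 2)) / (s - 1) @[s --> 1^'-] --> (0 : R);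
  penaliser_periodic : forall s : R, Psi ((2 + s) ^+ 2) = Psi (s ^+ 2)
}.

(* Meaningful only when s is not an even integer; at even integers Psi need not
   be differentiable at s^2 and the value is arbitrary. *)
Definition flux {R : realType} (Psi : R -> R) (s : R) : R :=
  derive1 Psi (s ^+ 2) * s.

(* The least Lipschitz constant; meaningful when f is Lipschitz on A. *)
Definition lipschitz_constant {R : realType} (A : set R) (f : R -> R) : R :=
  inf [set L : R | 0 <= L /\ L.-lipschitz_A f].

Definition J2 {R : realType} {N : nat} (u : 'I_N -> R) (i : 'I_N) : {set 'I_N} :=
  [set l | u l != u i]%SET.

(* Main.v *)
(* Write phi for the flux.  In the update of v i, the l-th weight multiplies
   phi (v l - v i) - phi (v l + v i), where the first term is absent if v l = v i.
   If L is the Lipschitz constant, this difference lies between - 2 L (v i) and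
   2 L (1 - v i): each bound follows either from the Lipschitz estimate between
   two points of (0, 2), after replacing phi (v l - v i) by
   phi (2 + v l - v i) when v l < v i, or from the sign of phi on (0, 1).
   The step size bound then keeps the whole increment strictly between
   - v i and 1 - v i. *)
Require Import Defs.
From mathcomp Require Import ring lra.

Set Implicit Arguments.
Unset Strict Implicit.
Unset Printing Implicit Defensive.

Local Open Scope classical_set_scope.
Local Open Scope ring_scope.

(** Near an interior point the constraint to [[a, b]] is void, so the relative limit is a two-sided
    derivative after the shift [y = h + x]. *)
Lemma is_derive_within_itv (R : realType) (a b : R) (f : R -> R) (x d : R) :
  x \in `]a, b[ ->
  (f y - f x) / (y - x) @[y --> within `[a, b] x^'] --> d ->
  is_derive x 1 f d.
Proof.
move=> xab fd.
have shift : h + x @[h --> 0^'] --> within `[a, b] x^'.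
  move=> A /= nA.
  have nA' : \forall y \near x, y != x -> A y.
    have nAI : \forall y \near x, y != x -> y \in `[a, b] -> A y by exact: nA.
    near=> y => yx; apply: (near nAI y) => //.
    by apply: subset_itv_oo_cc; near: y; exact: near_in_itvoo.
  have cx : h + x @[h --> (0 : R)] --> 0 + x.
    exact: (cvgD cvg_id (cvg_cst x)).
  rewrite add0r in cx.
  have nA0 : \forall h \near (0 : R), h + x != x -> A (h + x) := cx _ nA'.
  suff : \forall h \near (0 : R), h != 0 -> A (h + x) by [].
  near=> h => h0; apply: (near nA0 h) => //.
  by rewrite -subr_eq0 addrK.
have quot : h^-1 *: (f (h *: 1 + x) - f x) @[h --> 0^'] --> d.
  have := cvg_comp _ _ shift fd; apply: cvg_trans; apply: near_eq_cvg.
  by near=> h => /=; rewrite addrK mulrC [h *: 1]mulr1.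
apply: DeriveDef; first by apply/cvg_ex; exists d.
exact: (cvg_lim _ quot).
Unshelve. all: by end_near.
Qed.

(** Near [s ^+ 2], [Psi] is the composite of [fun x => Psi (x ^+ 2)] with the square root, so the
    chain rule yields the differentiability of [Psi] there as well as the factor [1 / (2 * s)]. *)
Lemma flux_is_derive (R : realType) (Psi : R -> R) (s d : R) :
  0 < s -> is_derive s 1 (fun x => Psi (x ^+ 2)) d -> flux Psi s = d / 2.
Proof.
move=> s0 gd.
have s20 : 0 < s ^+ 2 by rewrite exprn_gt0.
have gd' : is_derive (Num.sqrt (s ^+ 2)) 1 (fun x => Psi (x ^+ 2)) d.
  by rewrite sqrtr_sqr gtr0_norm.
have comp := is_derive1_comp gd' (is_derive1_sqrt s20).
have Psid : is_derive (s ^+ 2) 1 Psi (d * (2 * Num.sqrt (s ^+ 2))^-1).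
  apply: near_eq_is_derive comp.
  have pos : \forall y \near s ^+ 2, 0 < y by exact: lt_nbhsr.
  by near=> y => /=; rewrite sqr_sqrtr ?ltW//; exact: (near pos y).
rewrite /flux derive1E derive_val sqrtr_sqr gtr0_norm//.
by field; rewrite gt_eqF.
Unshelve. all: by end_near.
Qed.

(** For [x != y] the difference quotient is a lower bound of all Lipschitz constants, hence at most
    their infimum. *)
Lemma lipschitz_constantP (R : realType) (A : set R) (f : R -> R) :
  [lipschitz f x | x in A] ->
  forall x y, A x -> A y -> `|f x - f y| <= lipschitz_constant A f * `|x - y|.
Proof.
move=> fA x y Ax Ay; have [->|xy] := eqVneq x y; first by rewrite !subrr normr0 mulr0.
rewrite -ler_pdivrMr ?normr_gt0 ?subr_eq0//; apply: lb_le_inf.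
  have [M M0 lipM] : exists2 M, 0 <= M & M.-lipschitz_A f.
    (* The hypothesis only speaks of constants near infinity; this one lies past the threshold [M]
       and is nonnegative. *)
    have [M [_ /(_ (Num.max M 0 + 1))]] := fA.
    rewrite (le_lt_trans (_ : M <= Num.max M 0)) ?ltrDl ?le_max ?lexx// => /(_ isT).
    by exists (Num.max M 0 + 1) => //; rewrite addr_ge0// le_max lexx orbT.
  by exists M.
move=> M [M0 /(_ (x, y)) /=]; rewrite ler_pdivrMr ?normr_gt0 ?subr_eq0//.
exact.
Qed.

Lemma lipschitz_constant_ge0 (R : realType) (A : set R) (f : R -> R) :
  0 <= lipschitz_constant A f.
Proof.
rewrite /lipschitz_constant; set E := mkset _.
have [->|/set0P E0] := eqVneq E set0; first by rewrite inf0.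
by apply: lb_le_inf => // M [].
Qed.

Lemma penaliser_reflect (R : realType) (Psi : R -> R) (s : R) :
  penaliser Psi -> Psi ((2 - s) ^+ 2) = Psi (s ^+ 2).
Proof. by move=> hPsi; rewrite (penaliser_periodic hPsi) sqrrN. Qed.

Lemma penaliser_is_derive (R : realType) (Psi : R -> R) (s : R) :
  penaliser Psi -> 0 < s < 1 ->
  exists2 d, d <= 0 & is_derive s 1 (fun x => Psi (x ^+ 2)) d.
Proof.
move=> hPsi s01; have [df [hdf _]] := penaliser_C1 hPsi.
have derg (x : R) : x \in `]0, 1[ -> is_derive x 1 (fun x => Psi (x ^+ 2)) (df x).
  by move=> xI; apply: is_derive_within_itv (hdf x _) => //; exact: subset_itv_oo_cc.
have sI : s \in `]0, 1[ by rewrite in_itv.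
exists (df s); last exact: derg.
have ds := derg _ sI; rewrite -(@derive_val _ _ _ _ _ _ _ ds) -derive1E.
apply: (@decr_derive1_le0_itv _ _ true false 0 1) => //.
  by move=> x; rewrite inE => /derg /@ex_derive.
(* Strict decrease: with [m] the midpoint of [x < y] and [g] the function [s |-> Psi (s ^+ 2)],
   monotonicity gives [g y <= g m] and strict convexity [g m < (g x + g y) / 2]. *)
move=> y x yI xI xy.
have half : 0 < (2^-1 : R) < 1 by lra.
have mI : 2^-1 * x + (1 - 2^-1) * y \in `[0, 1].
  by move: xI yI; rewrite !in_itv/=; lra.
have my : 2^-1 * x + (1 - 2^-1) * y <= y by lra.
have := penaliser_decreasing hPsi mI yI my.
have := penaliser_convex hPsi xI yI (negbT (lt_eqF xy)) half.
lra.
Qed.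

Lemma fluxN (R : realType) (Psi : R -> R) (s : R) :
  flux Psi (- s) = - flux Psi s.
Proof. by rewrite /flux sqrrN mulrN. Qed.

Lemma flux_le0 (R : realType) (Psi : R -> R) (s : R) :
  penaliser Psi -> 0 < s < 1 -> flux Psi s <= 0.
Proof.
move=> hPsi s01; have [d d0 gd] := penaliser_is_derive hPsi s01.
rewrite (flux_is_derive _ gd); lra.
Qed.

(* This combines oddness and 2-periodicity of the flux; it follows from
   Psi ((2 - s)^2) = Psi (s^2) by the chain rule. *)
Lemma flux_reflect (R : realType) (Psi : R -> R) (s : R) :
  penaliser Psi -> 0 < s < 1 -> flux Psi (2 - s) = - flux Psi s.
Proof.
move=> hPsi s01; have [d _ gd] := penaliser_is_derive hPsi s01.
have gd' : is_derive (2 - (2 - s)) 1 (fun x => Psi (x ^+ 2)) d.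
  by rewrite opprB addrCA subrr addr0.
have sub : is_derive (2 - s) 1 (fun x : R => 2 - x) (- 1).
  by rewrite -[X in is_derive _ _ _ X]add0r; apply: is_deriveB.
have comp := @is_derive1_comp _ _ (fun x : R => 2 - x) _ _ _ gd' sub.
have compE : (fun x => Psi (x ^+ 2)) \o (fun x : R => 2 - x) = fun x => Psi (x ^+ 2).
  by apply/funext => x /=; rewrite penaliser_reflect.
rewrite compE in comp.
rewrite (flux_is_derive _ comp); last lra.
rewrite (flux_is_derive _ gd); lra.
Qed.

Section Bounds.
Variables (R : realType) (Psi : R -> R).
Hypothesis hPsi : penaliser Psi.
Hypothesis hPhi : [lipschitz (flux Psi s) | s in `]0%R, 2%R[].
Let phi := flux Psi.
Let L := lipschitz_constant `]0, 2[ phi.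

Lemma flux_lipschitz (s t : R) : 0 < s < 2 -> 0 < t < 2 ->
  `|phi s - phi t| <= L * `|s - t|.
Proof.
by move=> s02 t02; apply: lipschitz_constantP hPhi _ _ _ _ => /=; rewrite in_itv.
Qed.

(** The values at [s] and at its mirror image [2 - s] are opposite, so the Lipschitz estimate
    between them reads [2 * |phi s| <= L * 2 * (1 - s)]. *)
Lemma flux_left_bounds (s : R) : 0 < s < 1 -> - (L * (1 - s)) <= phi s <= 0.
Proof.
move=> s01; have phi0 := flux_le0 hPsi s01.
have s02 : 0 < s < 2 by lra.
have r02 : 0 < 2 - s < 2 by lra.
have := flux_lipschitz s02 r02.
rewrite /phi (flux_reflect hPsi s01) ler_norml => /andP[].
have -> : `|s - (2 - s)| = 2 * (1 - s) by rewrite ler0_norm; lra.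
rewrite -/phi in phi0 *; lra.
Qed.

(* Cruder than phi 1 = 0 would give, so that continuity of phi at 1 is not needed. *)
Lemma flux_bounds (s : R) : 0 < s < 2 -> - (L * (2 - s)) <= phi s <= L * s.
Proof.
move=> s02; have L0 : 0 <= L by exact: lipschitz_constant_ge0.
case: (ltgtP s 1) => [s1|s1|->].
- have s01 : 0 < s < 1 by lra.
  have := flux_left_bounds s01.
  have : 0 <= L * s by rewrite mulr_ge0; lra.
  lra.
- have s01 : 0 < 2 - s < 1 by lra.
  have := flux_left_bounds s01.
  have := flux_reflect hPsi s01; rewrite opprB addrCA subrr addr0 -/phi => ->.
  have : 0 <= L * (2 - s) by rewrite mulr_ge0; lra.
  lra.
(* At 1, comparison with the value at 1/2, which lies in [[- L / 2, 0]], places [phi 1] in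
   [[- L, L / 2]]. *)
- have h01 : 0 < (2^-1 : R) < 1 by lra.
  have h02 : 0 < (2^-1 : R) < 2 by lra.
  have o02 : 0 < (1 : R) < 2 by lra.
  have := flux_left_bounds h01.
  have := flux_lipschitz o02 h02.
  have -> : `|1 - 2^-1 : R| = 2^-1 by rewrite ger0_norm; lra.
  rewrite ler_norml; lra.
Qed.

Lemma flux_interaction_bounds (a b : R) : 0 < a < 1 -> 0 < b < 1 ->
  - (2 * L * a) <= (if b != a then phi (b - a) else 0) - phi (b + a)
                <= 2 * L * (1 - a).
Proof.
move=> a01 b01; have L0 : 0 <= L by exact: lipschitz_constant_ge0.
have s02 : 0 < b + a < 2 by lra.
have La : 0 <= L * a by rewrite mulr_ge0; lra.
have Lb : 0 <= L * b by rewrite mulr_ge0; lra.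
have bnd := flux_bounds s02.
case: (ltgtP b a) => [ba|ab|ba] /=.
(* The Lipschitz estimate gives the upper bound. For the lower one, [phi (b - a) >= 0] and
   [phi (b + a) <= L * (b + a) <= 2 * L * a]. *)
- have L' : 0 <= L * (a - b) by rewrite mulr_ge0; lra.
  have d01 : 0 < a - b < 1 by lra.
  have r02 : 0 < 2 - (a - b) < 2 by lra.
  have dle := flux_left_bounds d01.
  have := flux_lipschitz r02 s02.
  rewrite /phi (flux_reflect hPsi d01) -[b - a]opprB fluxN -/phi ler_norml.
  have -> : `|2 - (a - b) - (b + a)| = 2 * (1 - a) by rewrite ger0_norm; lra.
  lra.
(* The roles are exchanged: Lipschitz gives the lower bound, while [phi (b - a) <= 0] and
   [- phi (b + a) <= L * (2 - (b + a))] give the upper one. *)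
- have L' : 0 <= L * (b - a) by rewrite mulr_ge0; lra.
  have d01 : 0 < b - a < 1 by lra.
  have d02 : 0 < b - a < 2 by lra.
  have dle := flux_left_bounds d01.
  have := flux_lipschitz d02 s02; rewrite ler_norml.
  have -> : `|b - a - (b + a)| = 2 * a by rewrite ler0_norm; lra.
  lra.
- rewrite ba in bnd *; lra.
Qed.

End Bounds.

Theorem theorem9 (R : realType) (Psi : R -> R)
  (hPsi : penaliser Psi)
  (hPhi : [lipschitz (flux Psi s) | s in `]0%R, 2%R[])
  (N : nat) (w : 'M[R]_N)
  (w_ge0 : forall i j, 0 <= w i j)
  (w_diag : forall i, 0 < w i i)
  (v : nat -> 'I_N -> R) (k : nat) (tau : R)
  (hv : forall i, 0 < v k i < 1)
  (scheme : forall i, v k.+1 i =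
     v k i + tau * (\sum_(l in J2 (v k) i) w i l * flux Psi (v k l - v k i))
           - tau * (\sum_(l < N) w i l * flux Psi (v k l + v k i)))
  (htau : 0 < tau < 1 / (2 * lipschitz_constant `]0, 2[ (flux Psi)
                           * \big[Num.max/0]_(i < N) \sum_(l < N) w i l)) :
  forall i, 0 < v k.+1 i < 1.
Proof.
move=> i; have a01 := hv i.
set L := lipschitz_constant _ _ in htau.
set M := \big[_/_]_(_ < _) _ in htau.
set S := \sum_(l < N) w i l.
have SM : S <= M by exact: (le_bigmax 0 (fun i => \sum_(l < N) w i l) i).
have L0 : 0 <= L by exact: lipschitz_constant_ge0.
have /andP[tau0 tauLM] := htau.
(* Since the inverse of 0 is 0, the existence of [tau] in the open interval already excludes
   [L * M = 0]. *)
have LM0 : 0 < 2 * L * M.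
  by have := lt_trans tau0 tauLM; rewrite div1r invr_gt0.
have tauS : tau * (2 * L * S) < 1.
  rewrite ltr_pdivlMr// in tauLM; apply: le_lt_trans tauLM.
  by rewrite ler_wpM2l ?(ltW tau0)// ler_wpM2l// mulr_ge0.
set T := fun l => (if v k l != v k i then flux Psi (v k l - v k i) else 0)
                  - flux Psi (v k l + v k i).
have bnd l : - (2 * L * v k i) <= T l <= 2 * L * (1 - v k i).
  exact: flux_interaction_bounds.
(* The sum over [J2] becomes a sum over all indices with zero terms outside, so both sums merge. *)
have -> : v k.+1 i = v k i + tau * \sum_(l < N) w i l * T l.
  rewrite scheme -addrA -mulrBr big_mkcond -sumrB; congr (_ + _ * _).
  apply: eq_bigr => l _; rewrite inE /T mulrBr.
  by case: ifP => // _; rewrite mulr0.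
have lo : S * - (2 * L * v k i) <= \sum_(l < N) w i l * T l.
  rewrite mulr_suml; apply: ler_sum => l _.
  by apply: ler_wpM2l => //; case/andP: (bnd l).
have up : \sum_(l < N) w i l * T l <= S * (2 * L * (1 - v k i)).
  rewrite mulr_suml; apply: ler_sum => l _.
  by apply: ler_wpM2l => //; case/andP: (bnd l).
have lo' := ler_wpM2l (ltW tau0) lo; have up' := ler_wpM2l (ltW tau0) up.
have /andP[a0 a1] := a01.
have a1' : 0 < 1 - v k i by rewrite subr_gt0.
have lo2 : tau * (2 * L * S) * v k i < v k i by rewrite gtr_pMl.
have up2 : tau * (2 * L * S) * (1 - v k i) < 1 - v k i by rewrite gtr_pMl.
lra.
Qed.
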